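(* Let $G$ be a simple distance-regular graph with adjacency matrix $M$, let $r\le\operatorname{diam}(G)$ be a nonnegative integer, and let $p_r^B(x),p_r^W(x)\in\mathbb R[x]$ be polynomials expressing balls and spheres of radius $r$ in $G$, respectively, i.e. for each $u\in V(G)$ the rows $[p_r^B(M)]^u$ and $[p_r^W(M)]^u$ are the indicator functions of the ball $B_r(u)$ and of the sphere $W_r(u)$, respectively. Suppose that $f$ is a perfect coloring of $G$ with parameter matrix $S$. Then for all vertices $u,v\in V(G)$, $$|B_r(u)\,\Delta\,B_r(v)|\ \ge\ d([p_r^B(S)]^{f(u)},[p_r^B(S)]^{f(v)}),$$ $$|W_r(u)\,\Delta\,W_r(v)|\ \ge\ d([p_r^W(S)]^{f(u)},[p_r^W(S)]^{f(v)}).$$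
   Context: For vertices $u,v$ of $G$, $\rho(u,v)$ is the graph distance (length of a shortest path). The ball and sphere of radius $r$ with center $u$ are $B_r(u)=\{v:\rho(u,v)\le r\}$ and $W_r(u)=\{v:\rho(u,v)=r\}$. $\Delta$ denotes symmetric difference. A perfect coloring of $G$ with parameter matrix $S=(s_{i,j})$ of order $k$ is a map $f:V(G)\to\{1,\dots,k\}$ such that every vertex $u$ with $f(u)=i$ has exactly $s_{i,j}$ neighbors of color $j$, for all colors $i,j$. $[A]^i$ denotes the $i$-th row of a square matrix $A$. For real tuples $x,y$ of the same length, $d(x,y)=\sum_i|x_i-y_i|$ is the $L_1$ distance. (In a distance-regular graph, polynomials $p_r^B,p_r^W$ as in the claim exist for every $r\le\operatorname{diam}(G)$.) *)

(* Defs.v *)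
From mathcomp Require Import all_boot all_order all_algebra.
From mathcomp Require Import reals.

Set Implicit Arguments.
Unset Strict Implicit.
Unset Printing Implicit Defensive.
Import Order.TTheory GRing.Theory Num.Theory.
Local Open Scope ring_scope.

Section Graph.
Variables (V : finType) (e : rel V).

Definition simple_graph : Prop := symmetric e /\ irreflexive e.

Definition connected_graph : Prop := forall u v : V, connect e u v.

Definition has_walk (u v : V) (n : nat) : bool :=
  [exists p : n.-tuple V, path e u p && (last u p == v)].

(* A shortest path has fewer than #|V| edges, so the search is complete; the
   junk value #|V| is returned only when v is not reachable from u. *)
Definition gdist (u v : V) : nat := find (has_walk u v) (iota 0 #|V|).

Definition gball (r : nat) (u : V) : {set V} := [set v | (gdist u v <= r)%N].

Definition gsphere (r : nat) (u : V) : {set V} := [set v | gdist u v == r].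

Definition gdiam : nat := \max_(u : V) \max_(v : V) gdist u v.

(* The number of vertices at distance i from u and j from v depends only on
   i, j and the distance between u and v. *)
Definition distance_regular : Prop :=
  connected_graph /\
  forall (i j : nat) (u v u' v' : V), gdist u v = gdist u' v' ->
    #|gsphere i u :&: gsphere j v| = #|gsphere i u' :&: gsphere j v'|.

Lemma has_walkP (u v : V) (n : nat) :
  reflect (exists p : seq V, [/\ path e u p, last u p = v & size p = n])
          (has_walk u v n).
Proof.
apply: (iffP existsP) => [[p /andP[pp /eqP pl]]|[p [pp pl ps]]].
  by exists p; rewrite size_tuple.
by move/eqP: ps => ps; exists (Tuple ps); rewrite pp /= pl eqxx.
Qed.

Lemma gdist_path (u v : V) : connect e u v ->
  exists p : seq V, [/\ path e u p, last u p = v & size p = gdist u v].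
Proof.
move=> /connectP[p0 pp0 ->]; case/shortenP: pp0 => p pp up _.
apply: (elimT (has_walkP u (last u p) (gdist u (last u p)))).
have sp : (size p < #|V|)%N.
  by have /card_uniqP/= <- := up; exact: max_card.
have H : has (has_walk u (last u p)) (iota 0 #|V|).
  apply/hasP; exists (size p); first by rewrite mem_iota.
  by apply/(has_walkP u (last u p) (size p)); exists p.
have := nth_find 0%N H; rewrite nth_iota //.
by rewrite -[X in (_ < X)%N](size_iota 0) -has_find.
Qed.

Lemma gdist_le (u : V) (p : seq V) : path e u p ->
  (gdist u (last u p) <= size p)%N.
Proof.
move=> pp; rewrite leqNgt; apply/negP => lt.
have szV : (size p < #|V|)%N.
  by apply: leq_trans lt _; rewrite -[X in (_ <= X)%N](size_iota 0) find_size.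
have := before_find 0%N lt; rewrite nth_iota // add0n => nw.
suff : has_walk u (last u p) (size p) by rewrite nw.
by apply/has_walkP; exists p.
Qed.

End Graph.

Definition setsymdiff (T : finType) (A B : {set T}) : {set T} :=
  (A :\: B) :|: (B :\: A).

Section Matrices.
Variable R : realType.

(* Evaluation of a polynomial at a square matrix of arbitrary size;
   [horner_mx] is only available for sizes of the form n.+1. *)
Definition polymx (n : nat) (p : {poly R}) (A : 'M[R]_n) : 'M[R]_n :=
  \sum_(i < size p) p`_i *: A ^+ i.

Lemma polymxE (n : nat) (p : {poly R}) (A : 'M[R]_n.+1) :
  polymx p A = horner_mx A p.
Proof.
rewrite /polymx -[in RHS](coefK p) poly_def rmorph_sum /=.
by apply: eq_bigr => i _; rewrite linearZ rmorphXn /= horner_mx_X.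
Qed.

(* Vertices index the rows and columns through [enum_val]/[enum_rank]. *)
Definition adjacency_mx (V : finType) (e : rel V) : 'M[R]_#|V| :=
  \matrix_(i, j) (e (enum_val i) (enum_val j))%:R.

Definition indicator_row (V : finType) (A : {set V}) : 'rV[R]_#|V| :=
  \row_j (enum_val j \in A)%:R.

Definition expresses_balls (V : finType) (e : rel V) (r : nat)
    (p : {poly R}) : Prop :=
  forall u : V, row (enum_rank u) (polymx p (adjacency_mx e)) =
                indicator_row (gball e r u).

Definition expresses_spheres (V : finType) (e : rel V) (r : nat)
    (p : {poly R}) : Prop :=
  forall u : V, row (enum_rank u) (polymx p (adjacency_mx e)) =
                indicator_row (gsphere e r u).

(* Surjectivity is not required: the rows of S indexed by unused colors are
   unconstrained. *)
Definition perfect_coloring (V : finType) (e : rel V) (k : nat)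
    (f : V -> 'I_k) (S : 'M[R]_k) : Prop :=
  forall (u : V) (j : 'I_k), S (f u) j = #|[set v | e u v & f v == j]|%:R.

Definition l1dist (k : nat) (x y : 'rV[R]_k) : R :=
  \sum_(i < k) `|x 0 i - y 0 i|.

End Matrices.

(* Main.v *)
(** Let F be the 0/1 matrix of color classes, F w c = [f w = c].  A coloring is
    perfect exactly when M F = F S, hence p(M) F = F p(S) for every polynomial p.
    If the rows of p(M) are the indicators of sets A(u), then row f(u) of p(S)
    is the indicator of A(u) times F.  Right multiplication by F contracts the
    L1 distance, and the L1 distance of two indicators is the size of the
    symmetric difference. *)
Require Import Defs.
From mathcomp Require Import all_boot all_order all_algebra.
From mathcomp Require Import reals.
Import Order.TTheory GRing.Theory Num.Theory.
Local Open Scope ring_scope.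

Definition color_mx (R : realType) (V : finType) (k : nat) (f : V -> 'I_k) :
    'M[R]_(#|V|, k) :=
  \matrix_(i, c) (f (enum_val i) == c)%:R.

(** Row [u] of [color_mx] is the unit vector at [f u], so left multiplication by it selects a row of
    [A]. *)
Lemma row_color_mulmx (R : realType) (V : finType) (k n : nat) (f : V -> 'I_k)
    (A : 'M[R]_(k, n)) (u : V) :
  row (enum_rank u) (color_mx R V k f *m A) = row (f u) A.
Proof.
apply/rowP => c; rewrite !mxE (bigD1 (f u)) //= big1 => [|j /negPf ne].
  by rewrite !mxE enum_rankK eqxx mul1r addr0.
by rewrite !mxE enum_rankK eq_sym ne mul0r.
Qed.

(** At vertex [u] and color [c], both sides count the neighbors of [u] colored [c]. *)
Lemma adjacency_mul_color (R : realType) (V : finType) (e : rel V) (k : nat)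
    (f : V -> 'I_k) (S : 'M[R]_k) :
  perfect_coloring e f S ->
  adjacency_mx R e *m color_mx R V k f = color_mx R V k f *m S.
Proof.
move=> hf; apply/row_matrixP => i.
rewrite -[i]enum_valK row_color_mulmx; apply/rowP => c.
rewrite !mxE hf -sum1_card natr_sum [RHS]big_mkcond /=.
rewrite [RHS](reindex (@enum_val V V)) /=; last first.
  by apply: onW_bij; exact: enum_val_bij.
apply: eq_bigr => j _; rewrite !mxE inE enum_rankK.
by case: (e _ _); case: (_ == _); rewrite /= ?(mul0r, mul1r).
Qed.

(** By linearity it suffices to treat powers, where [F] is moved past one factor at a time. *)
Lemma polymx_intertwine (R : realType) (m n : nat) (A : 'M[R]_m) (B : 'M[R]_n)
    (F : 'M[R]_(m, n)) (p : {poly R}) :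
  A *m F = F *m B -> polymx p A *m F = F *m polymx p B.
Proof.
move=> AF; rewrite mulmx_suml mulmx_sumr; apply: eq_bigr => i _.
rewrite -scalemxAl -scalemxAr; congr (_ *: _).
elim: (i : nat) => [|j IH]; first by rewrite !expr0 mul1mx mulmx1.
(* Restating the power rule with [*m] lets associativity apply across the rectangular [F]. *)
have expS q (C : 'M[R]_q) : C ^+ j.+1 = C *m C ^+ j by rewrite exprS.
by rewrite !expS -mulmxA IH !mulmxA AF.
Qed.

(** This is the triangle inequality inside each color class. *)
Lemma l1dist_color_mulmx (R : realType) (V : finType) (k : nat) (f : V -> 'I_k)
    (x y : 'rV[R]_#|V|) :
  l1dist (x *m color_mx R V k f) (y *m color_mx R V k f) <= l1dist x y.
Proof.
pose F := color_mx R V k f.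
(* Each row of [F] sums to 1, so every term can be split over the colors. *)
have -> : l1dist x y = \sum_(c < k) \sum_j `|x 0 j - y 0 j| * F j c.
  rewrite exchange_big; apply: eq_bigr => j _; rewrite -mulr_sumr.
  rewrite (bigD1 (f (enum_val j))) //= big1 => [|c /negPf ne].
    by rewrite mxE eqxx addr0 mulr1.
  by rewrite mxE eq_sym ne.
apply: ler_sum => c _; rewrite !mxE -sumrB.
apply: le_trans (ler_norm_sum _ _ _) _; apply: ler_sum => j _.
by rewrite -mulrBl normrM (ger0_norm (x := F j c)) // mxE ler0n.
Qed.

(** Two 0/1 values differ by 1 in absolute value exactly on the symmetric difference. *)
Lemma l1dist_indicator (R : realType) (V : finType) (A B : {set V}) :
  l1dist (indicator_row R A) (indicator_row R B) = #|setsymdiff A B|%:R.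
Proof.
rewrite -sum1_card natr_sum [RHS]big_mkcond /=.
rewrite [RHS](reindex (@enum_val V V)) /=; last first.
  by apply: onW_bij; exact: enum_val_bij.
apply: eq_bigr => j _; rewrite !mxE !inE.
by case: (_ \in A); case: (_ \in B);
  rewrite /= ?subrr ?subr0 ?sub0r ?normrN ?normr0 ?normr1.
Qed.

(** The family [A] is arbitrary, so that balls and spheres are both instances. *)
Lemma perfect_coloring_l1dist (R : realType) (V : finType) (e : rel V)
    (p : {poly R}) (A : V -> {set V}) (k : nat) (f : V -> 'I_k) (S : 'M[R]_k) :
  perfect_coloring e f S ->
  (forall u, row (enum_rank u) (polymx p (adjacency_mx R e)) =
             indicator_row R (A u)) ->
  forall u v, l1dist (row (f u) (polymx p S)) (row (f v) (polymx p S))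
                <= #|setsymdiff (A u) (A v)|%:R.
Proof.
(* Rows of [polymx p S] are lifted from colors to vertices, where the intertwining relation
   applies. *)
move=> hf hA u v; rewrite -(row_color_mulmx _ _ _ _ f _ u) -(row_color_mulmx _ _ _ _ f _ v).
rewrite -(polymx_intertwine _ _ _ _ _ _ p (adjacency_mul_color _ _ _ _ _ _ hf)).
by rewrite !row_mul !hA -l1dist_indicator l1dist_color_mulmx.
Qed.

Theorem theorem5 (R : realType) (V : finType) (e : rel V)
    (hsimple : simple_graph e) (hdr : distance_regular e)
    (r : nat) (hr : (r <= gdiam e)%N)
    (pB pW : {poly R})
    (hpB : expresses_balls e r pB) (hpW : expresses_spheres e r pW)
    (k : nat) (f : V -> 'I_k) (S : 'M[R]_k)
    (hf : perfect_coloring e f S) :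
  forall u v : V,
    l1dist (row (f u) (polymx pB S)) (row (f v) (polymx pB S))
      <= #|setsymdiff (gball e r u) (gball e r v)|%:R
    /\
    l1dist (row (f u) (polymx pW S)) (row (f v) (polymx pW S))
      <= #|setsymdiff (gsphere e r u) (gsphere e r v)|%:R.
Proof.
move=> u v; split.
- exact: (perfect_coloring_l1dist _ _ e pB (gball e r) k f S hf hpB u v).
- exact: (perfect_coloring_l1dist _ _ e pW (gsphere e r) k f S hf hpW u v).
Qed.
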